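(* Let $k\in\{1,\dots,N\}$, $r>0$, $N_s\ge2$, and let $\tilde{\omega}\in\left(\frac{1}{N_s+1},1\right]$ be a fixed risk allocation value; put $$\tilde\lambda=\frac{\sqrt{(N_s+1)(1-\tilde\omega)}}{\sqrt{N_s\tilde\omega}-\sqrt{1-\tilde\omega}}.$$ For any values of the disturbance samples, the collision avoidance constraint $$\hat{\mathbb{E}}\left[\|\vec{z}+\vec{\boldsymbol{z}}\|^2\right]-\tilde\lambda\,\hat{\mathrm{Std}}\left(\|\vec{z}+\vec{\boldsymbol{z}}\|^2\right)\ge r^2$$ is a difference-of-convex-functions constraint, in the following sense. (i) (Obstacle avoidance.) If $\vec{z}=S\left(A^k\vec{x}_i(0)+\mathcal{C}(k)\vec{U}_i-\vec{o}(k)\right)$ and $\vec{\boldsymbol{z}}^{[l]}=S\mathcal{D}(k)\vec{\boldsymbol{W}}_i^{[l]}$ for $l=1,\dots,N_s$, then the left-hand side of the constraint is a difference of two convex functions of $\vec{U}_i$. (ii) (Inter-vehicle avoidance.) If $\vec{z}=S\left(A^k(\vec{x}_i(0)-\vec{x}_j(0))+\mathcal{C}(k)(\vec{U}_i-\vec{U}_j)\right)$ and $\vec{\boldsymbol{z}}^{[l]}=S\mathcal{D}(k)(\vec{\boldsymbol{W}}_i^{[l]}-\vec{\boldsymbol{W}}_j^{[l]})$ for $l=1,\dots,N_s$, then the left-hand side of the constraint is a difference of two convex functions of $\vec{U}_i-\vec{U}_j$.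
   Context: Setting. Vehicle $i$ evolves by $\vec{\boldsymbol{x}}_i(k+1)=A\vec{\boldsymbol{x}}_i(k)+B\vec{u}_i(k)+\vec{\boldsymbol{w}}_i(k)$ over a horizon of $N$ steps, with $A\in\mathbb{R}^{n\times n}$, $B\in\mathbb{R}^{n\times m}$, known initial state $\vec{x}_i(0)\in\mathbb{R}^n$, and similarly for vehicle $j$. Stack the inputs as $\vec{U}_i=[\vec{u}_i(0)^\top\ \cdots\ \vec{u}_i(N-1)^\top]^\top\in\mathbb{R}^{Nm}$ and the disturbances as $\vec{\boldsymbol{W}}_i=[\vec{\boldsymbol{w}}_i(0)^\top\ \cdots\ \vec{\boldsymbol{w}}_i(N-1)^\top]^\top\in\mathbb{R}^{Nn}$, and set $\mathcal{C}(k)=[A^{k-1}B\ \cdots\ AB\ B\ 0_{n\times(N-k)m}]\in\mathbb{R}^{n\times Nm}$ and $\mathcal{D}(k)=[A^{k-1}\ \cdots\ A\ I_n\ 0_{n\times(N-k)n}]\in\mathbb{R}^{n\times Nn}$. The matrix $S\in\mathbb{R}^{q\times n}$ (extracting positions) and the obstacle location $\vec{o}(k)\in\mathbb{R}^n$ are fixed and non-random, and $\|\cdot\|$ is the Euclidean norm. Vectors $\vec{\boldsymbol{W}}_i^{[1]},\dots,\vec{\boldsymbol{W}}_i^{[N_s]}$ are given samples (fixed values) of the disturbance of vehicle $i$, and likewise for $j$. Given $\vec{z}\in\mathbb{R}^q$ and samples $\vec{\boldsymbol{z}}^{[1]},\dots,\vec{\boldsymbol{z}}^{[N_s]}\in\mathbb{R}^q$,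 the sample mean and sample standard deviation of $\|\vec{z}+\vec{\boldsymbol{z}}\|^2$ are $$\hat{\mathbb{E}}\left[\|\vec{z}+\vec{\boldsymbol{z}}\|^2\right]=\frac1{N_s}\sum_{l=1}^{N_s}\|\vec{z}+\vec{\boldsymbol{z}}^{[l]}\|^2,\qquad \hat{\mathrm{Std}}\left(\|\vec{z}+\vec{\boldsymbol{z}}\|^2\right)=\sqrt{\frac1{N_s}\sum_{l=1}^{N_s}\left(\|\vec{z}+\vec{\boldsymbol{z}}^{[l]}\|^2-\hat{\mathbb{E}}\left[\|\vec{z}+\vec{\boldsymbol{z}}\|^2\right]\right)^2}.$$ A function is a difference of convex functions on $\mathbb{R}^d$ if it can be written as $f-g$ with $f,g:\mathbb{R}^d\to\mathbb{R}$ convex. Here $d=Nm$. *)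

(* Defs.v *)
From mathcomp Require Import all_boot all_order all_algebra.
From mathcomp Require Import classical_sets reals convex.

Set Implicit Arguments.
Unset Strict Implicit.
Unset Printing Implicit Defensive.

Import Order.TTheory GRing.Theory Num.Theory.
Local Open Scope classical_set_scope.
Local Open Scope ring_scope.

(* Not [`|v|], which is the max norm on matrices. *)
Definition enorm (R : rcfType) (d : nat) (v : 'cV[R]_d) : R :=
  Num.sqrt (\sum_(i < d) v i 0 ^+ 2).

Lemma stack_dim (N m : nat) : (\sum_(t < N) m = N * m)%N.
Proof. by rewrite sum_nat_const card_ord. Qed.

(* Inputs and disturbances are stacked with block [t] (occupying rows
   [t * m, ..., t * m + m - 1]) holding the value at time [t < N]; the block
   rows below are indexed accordingly, with zero blocks for [k <= t < N]. *)

(* [A^(k-1) B, ..., A B, B, 0] *)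
Definition input_mx (R : pzRingType) (n m : nat) (A : 'M[R]_n)
    (B : 'M[R]_(n, m)) (N k : nat) : 'M[R]_(n, N * m) :=
  castmx (erefl n, stack_dim N m)
    (\mxrow_(t < N) (if (t < k)%N then (A ^+ (k - 1 - t)) *m B else 0)).

(* [A^(k-1), ..., A, I_n, 0] *)
Definition disturbance_mx (R : pzRingType) (n : nat) (A : 'M[R]_n)
    (N k : nat) : 'M[R]_(n, N * n) :=
  castmx (erefl n, stack_dim N n)
    (\mxrow_(t < N) (if (t < k)%N then A ^+ (k - 1 - t) else 0)).

Definition sample_mean (R : rcfType) (Ns : nat) (y : 'I_Ns -> R) : R :=
  Ns%:R^-1 * \sum_(l < Ns) y l.

Definition sample_std (R : rcfType) (Ns : nat) (y : 'I_Ns -> R) : R :=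
  Num.sqrt (Ns%:R^-1 * \sum_(l < Ns) (y l - sample_mean y) ^+ 2).

Definition risk_multiplier (R : rcfType) (Ns : nat) (omega : R) : R :=
  Num.sqrt ((Ns%:R + 1) * (1 - omega)) /
  (Num.sqrt (Ns%:R * omega) - Num.sqrt (1 - omega)).

(* The left-hand side of the collision avoidance constraint
   [_ >= r ^+ 2]. *)
Definition avoidance_lhs (R : rcfType) (q Ns : nat) (lambda : R)
    (z : 'cV[R]_q) (zs : 'I_Ns -> 'cV[R]_q) : R :=
  let y l := enorm (z + zs l) ^+ 2 in
  sample_mean y - lambda * sample_std y.

Definition diff_convex (R : realType) (d : nat) (F : 'cV[R]_d -> R) : Prop :=
  exists f g : 'cV[R]_d -> R,
    [/\ @convex_function R 'cV[R]_d setT f,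
        @convex_function R 'cV[R]_d setT g &
        forall x, F x = f x - g x].

(* Main.v *)
(** The mean of the squared norms is a mean of squares of affine functions,
    hence convex. Expanding [|z + z_l|^2 = |z|^2 + 2 <z, z_l> + |z_l|^2], the
    quadratic term does not depend on [l] and drops out of the deviations from
    the mean, so the standard deviation is a seminorm (which is invariant
    under shifts) evaluated at functions that are affine in the input, and it
    is convex as well. *)
Require Import Defs.
From mathcomp Require Import all_boot all_order all_algebra.
From mathcomp Require Import classical_sets reals convex.
From mathcomp Require Import interval_inference ring.

Import Order.TTheory GRing.Theory Num.Theory.
Local Open Scope ring_scope.

(** Twice the gap between the two sides is a double sum of squares. *)
Lemma sum_CauchySchwarz (R : realDomainType) (I : finType) (a b : I -> R) :
  (\sum_i a i * b i) ^+ 2 <= (\sum_i a i ^+ 2) * (\sum_i b i ^+ 2).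
Proof.
(* Lagrange's identity *)
have : 0 <= \sum_i \sum_j (a i * b j - a j * b i) ^+ 2.
  by apply: sumr_ge0 => i _; apply: sumr_ge0 => j _; exact: sqr_ge0.
have -> : \sum_i \sum_j (a i * b j - a j * b i) ^+ 2 =
    ((\sum_i a i ^+ 2) * (\sum_i b i ^+ 2) - (\sum_i a i * b i) ^+ 2) *+ 2.
  have -> : \sum_i \sum_j (a i * b j - a j * b i) ^+ 2 =
      \sum_i \sum_j (a i ^+ 2 * b j ^+ 2)
      + \sum_i \sum_j (a j ^+ 2 * b i ^+ 2)
      - (\sum_i \sum_j (a i * b i) * (a j * b j)) *+ 2.
    rewrite -sumrMnl -big_split -sumrB /=; apply: eq_bigr => i _.
    rewrite -sumrMnl -big_split -sumrB /=; apply: eq_bigr => j _; ring.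
  (* Exchanging the summations turns the second double sum into the first, which accounts for the
     factor 2. *)
  rewrite [X in _ + X - _]exchange_big /= expr2 !big_distrlr /=.
  ring.
by rewrite pmulrn_lge0 // subr_ge0.
Qed.

(** Minkowski's inequality for the Euclidean norm: after squaring, only the cross terms differ, and
    Cauchy-Schwarz compares them. *)
Lemma sqrt_sum_sqrD_le (R : rcfType) (I : finType) (a b : I -> R) :
  Num.sqrt (\sum_i (a i + b i) ^+ 2)
  <= Num.sqrt (\sum_i a i ^+ 2) + Num.sqrt (\sum_i b i ^+ 2).
Proof.
have sum_sqr_ge0 (c : I -> R) : 0 <= \sum_i c i ^+ 2.
  by apply: sumr_ge0 => i _; exact: sqr_ge0.
rewrite -[leRHS]ger0_norm ?addr_ge0 ?sqrtr_ge0 // -sqrtr_sqr ler_wsqrtr //.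
have -> : \sum_i (a i + b i) ^+ 2 =
    \sum_i a i ^+ 2 + (\sum_i a i * b i) *+ 2 + \sum_i b i ^+ 2.
  rewrite -sumrMnl -!big_split /=; apply: eq_bigr => i _; exact: sqrrD.
rewrite sqrrD !sqr_sqrtr // lerD2r lerD2l lerMn2r /= -sqrtrM //.
by rewrite (le_trans (ler_norm _)) // -sqrtr_sqr ler_wsqrtr // sum_CauchySchwarz.
Qed.

Lemma sample_meanD (R : rcfType) (Ns : nat) (y y' : 'I_Ns -> R) :
  sample_mean (fun l => y l + y' l) = sample_mean y + sample_mean y'.
Proof. by rewrite /sample_mean big_split mulrDr. Qed.

Lemma sample_meanZ (R : rcfType) (Ns : nat) (s : R) (y : 'I_Ns -> R) :
  sample_mean (fun l => s * y l) = s * sample_mean y.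
Proof. by rewrite /sample_mean -mulr_sumr mulrCA. Qed.

Lemma sample_mean_cst (R : rcfType) (Ns : nat) (c : R) :
  (0 < Ns)%N -> sample_mean (fun _ : 'I_Ns => c) = c.
Proof.
move=> Ns0; rewrite /sample_mean sumr_const card_ord -[c *+ _]mulr_natl mulKf //.
by rewrite pnatr_eq0 -lt0n.
Qed.

Lemma ler_sample_mean (R : rcfType) (Ns : nat) (y y' : 'I_Ns -> R) :
  (forall l, y l <= y' l) -> sample_mean y <= sample_mean y'.
Proof.
by move=> yy'; rewrite ler_wpM2l ?invr_ge0 ?ler0n // ler_sum.
Qed.

(** The standard deviation is a scaled Euclidean norm of the centred sample, and centring is
    additive, so Minkowski's inequality applies. *)
Lemma sample_stdD_le (R : rcfType) (Ns : nat) (y y' : 'I_Ns -> R) :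
  sample_std (fun l => y l + y' l) <= sample_std y + sample_std y'.
Proof.
rewrite /sample_std !sqrtrM ?invr_ge0 ?ler0n // -mulrDr ler_wpM2l ?sqrtr_ge0 //.
rewrite (le_trans _ (sqrt_sum_sqrD_le _ _ _ _)) // sample_meanD.
by under eq_bigr do rewrite opprD addrACA.
Qed.

Lemma sample_stdZ (R : rcfType) (Ns : nat) (s : R) (y : 'I_Ns -> R) :
  0 <= s -> sample_std (fun l => s * y l) = s * sample_std y.
Proof.
move=> s0; rewrite /sample_std sample_meanZ.
under eq_bigr do rewrite -mulrBr exprMn.
by rewrite -mulr_sumr mulrCA sqrtrM ?sqr_ge0 // sqrtr_sqr ger0_norm.
Qed.

Lemma sample_std_shift (R : rcfType) (Ns : nat) (c : R) (y : 'I_Ns -> R) :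
  (0 < Ns)%N -> sample_std (fun l => c + y l) = sample_std y.
Proof.
move=> Ns0; rewrite /sample_std sample_meanD sample_mean_cst //.
by under eq_bigr do rewrite opprD addrACA subrr add0r.
Qed.

Lemma eq_sample_std (R : rcfType) (Ns : nat) (y y' : 'I_Ns -> R) :
  y =1 y' -> sample_std y = sample_std y'.
Proof.
move=> yy'; have meanE : sample_mean y = sample_mean y'.
  by congr (_ * _); apply: eq_bigr => l _.
by rewrite /sample_std meanE; under eq_bigr do rewrite yy'.
Qed.

Lemma sqr_convex (R : realDomainType) (t a b : R) : 0 <= t <= 1 ->
  (t * a + (1 - t) * b) ^+ 2 <= t * a ^+ 2 + (1 - t) * b ^+ 2.
Proof.
move=> /andP[t0 t1]; rewrite -subr_ge0.
have -> : t * a ^+ 2 + (1 - t) * b ^+ 2 - (t * a + (1 - t) * b) ^+ 2 =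
    t * (1 - t) * (a - b) ^+ 2 by ring.
by rewrite mulr_ge0 ?sqr_ge0 // mulr_ge0 ?subr_ge0.
Qed.

Lemma enorm_sqr (R : rcfType) (d : nat) (v : 'cV[R]_d) :
  enorm v ^+ 2 = \sum_(i < d) v i 0 ^+ 2.
Proof. by rewrite sqr_sqrtr // sumr_ge0 // => i _; exact: sqr_ge0. Qed.

Lemma enorm_sqr_convex (R : rcfType) (d : nat) (t : R) (u v : 'cV[R]_d) :
  0 <= t <= 1 ->
  enorm (t *: u + (1 - t) *: v) ^+ 2
  <= t * enorm u ^+ 2 + (1 - t) * enorm v ^+ 2.
Proof.
move=> t01; rewrite !enorm_sqr !mulr_sumr -big_split /= ler_sum // => i _.
by rewrite !mxE sqr_convex.
Qed.

(** Replaces the bundled weights of [convex_function] by plain scalars in the unit interval. *)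
Lemma convex_functionTP (R : numFieldType) (E : lmodType R) (f : E -> R) :
  (forall t x y, 0 <= t <= 1 ->
    f (t *: x + (1 - t) *: y) <= t * f x + (1 - t) * f y) ->
  @convex_function R E setT f.
Proof. by move=> cf t x y _ _; apply: cf; rewrite ge0 le1. Qed.

Section AffineConvexity.
Context (R : realType) (q d Ns : nat) (M : 'M[R]_(q, d)) (v : 'cV[R]_q)
  (zs : 'I_Ns -> 'cV[R]_q).

Let y (U : 'cV[R]_d) l := enorm (M *m U + v + zs l) ^+ 2.

(** The weights sum to 1, so the constant [w] can be split between the two points. It is used with
    [w] equal to [v + zs l] for the mean and to [v] for the deviation. *)
Let affine_conv (w : 'cV[R]_q) t (x x' : 'cV[R]_d) :
  M *m (t *: x + (1 - t) *: x') + w =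
  t *: (M *m x + w) + (1 - t) *: (M *m x' + w).
Proof.
rewrite !scalerDr addrACA -scalerDl [t + _]addrC subrK scale1r.
by rewrite mulmxDr -!scalemxAr.
Qed.

Lemma sample_mean_sqr_convex :
  @convex_function R 'cV[R]_d setT (fun U => sample_mean (y U)).
Proof.
apply: convex_functionTP => t x x' t01.
rewrite -!sample_meanZ -sample_meanD ler_sample_mean // => l.
by rewrite /y -!addrA affine_conv enorm_sqr_convex.
Qed.

Lemma sample_std_sqr_convex : (0 < Ns)%N ->
  @convex_function R 'cV[R]_d setT (fun U => sample_std (y U)).
Proof.
move=> Ns0.
(* This is [y U l] without its quadratic part: the sum encodes [2 <z, z_l> + |z_l|^2] with
   [z = M *m U + v], which is affine in [U] for each [l]. *)
pose u U l := \sum_(i < q) zs l i 0 * ((M *m U + v) i 0 *+ 2 + zs l i 0).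
have stdE U : sample_std (y U) = sample_std (u U).
  (* The shift depends on [U] but is the same for every sample [l]. *)
  rewrite -(@sample_std_shift _ _ (enorm (M *m U + v) ^+ 2) (u U)) //.
  apply: eq_sample_std => l; rewrite /y /u !enorm_sqr -big_split /=.
  by apply: eq_bigr => i _; rewrite [in LHS]mxE; ring.
apply: convex_functionTP => t x x' /andP[t0 t1]; rewrite !stdE.
rewrite -!sample_stdZ ?subr_ge0 //.
(* The triangle inequality is the only loss: since [u] is affine in its first argument, the two
   samples left to compare are equal. *)
rewrite (le_trans _ (sample_stdD_le _ _ _ _)) // le_eqVlt.
apply/orP; left; apply/eqP/eq_sample_std => l.
rewrite /u !mulr_sumr -big_split /=; apply: eq_bigr => i _.
rewrite affine_conv !mxE; ring.
Qed.

End AffineConvexity.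

(** The sign of [lambda] decides where the second term goes: if nonnegative, [lambda * g] is the
    convex function subtracted; if negative, [- lambda * g] is convex and joins [f], and 0 is
    subtracted. *)
Lemma diff_convexBZ (R : realType) (d : nat) (lambda : R)
    (f g : 'cV[R]_d -> R) :
  @convex_function R 'cV[R]_d setT f -> @convex_function R 'cV[R]_d setT g ->
  diff_convex (fun x => f x - lambda * g x).
Proof.
have convexDZ (c : R) (f1 f2 : 'cV[R]_d -> R) : 0 <= c ->
    @convex_function R 'cV[R]_d setT f1 -> @convex_function R 'cV[R]_d setT f2 ->
    @convex_function R 'cV[R]_d setT (fun x => f1 x + c * f2 x).
  move=> c0 cf1 cf2 t x y xT yT; rewrite convRE.
  have := lerD (cf1 t x y xT yT) (ler_wpM2l c0 (cf2 t x y xT yT)).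
  move=> /le_trans; apply; rewrite le_eqVlt; apply/orP; left; apply/eqP.
  by rewrite !convRE; ring.
have convex0 : @convex_function R 'cV[R]_d setT (fun=> 0).
  by move=> t x y _ _; rewrite convRE !mulr0 addr0.
move=> cf cg; have [l0|/ltW l0] := leP 0 lambda.
- exists f, (fun x => 0 + lambda * g x); split => //; first exact: convexDZ.
  by move=> x; rewrite add0r.
- exists (fun x => f x + - lambda * g x), (fun=> 0); split => //.
    by apply: convexDZ => //; rewrite oppr_ge0.
  by move=> x; rewrite subr0 mulNr.
Qed.

Lemma avoidance_lhs_diff_convex (R : realType) (q d Ns : nat) (lambda : R)
    (M : 'M[R]_(q, d)) (v : 'cV[R]_q) (zs : 'I_Ns -> 'cV[R]_q) :
  (0 < Ns)%N ->
  diff_convex (fun U : 'cV[R]_d => avoidance_lhs lambda (M *m U + v) zs).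
Proof.
move=> Ns0; apply: diff_convexBZ; first exact: sample_mean_sqr_convex.
exact: sample_std_sqr_convex.
Qed.

Theorem lemma3 (R : realType) (n m q N Ns : nat)
    (A : 'M[R]_n) (B : 'M[R]_(n, m)) (S : 'M[R]_(q, n))
    (o : nat -> 'cV[R]_n) (xi0 xj0 : 'cV[R]_n)
    (Wi Wj : 'I_Ns -> 'cV[R]_(N * n))
    (k : nat) (r omega : R)
    (hk : (1 <= k <= N)%N) (hr : 0 < r) (hNs : (2 <= Ns)%N)
    (homega : 1 / (Ns%:R + 1) < omega <= 1) :
  diff_convex (fun Ui : 'cV[R]_(N * m) =>
    avoidance_lhs (risk_multiplier Ns omega)
      (S *m (A ^+ k *m xi0 + input_mx A B N k *m Ui - o k))
      (fun l : 'I_Ns => S *m disturbance_mx A N k *m Wi l))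
  /\
  (exists F : 'cV[R]_(N * m) -> R,
    diff_convex F /\
    forall Ui Uj : 'cV[R]_(N * m),
      avoidance_lhs (risk_multiplier Ns omega)
        (S *m (A ^+ k *m (xi0 - xj0) + input_mx A B N k *m (Ui - Uj)))
        (fun l : 'I_Ns => S *m disturbance_mx A N k *m (Wi l - Wj l))
      = F (Ui - Uj)).
Proof.
have Ns0 : (0 < Ns)%N by exact: ltnW.
(* Both constraints have this shape and differ only in the constant [v] and in the samples. *)
have diff_convex_affine lambda v (zs : 'I_Ns -> 'cV[R]_q) :
    diff_convex (fun U : 'cV[R]_(N * m) =>
    avoidance_lhs lambda (S *m (v + input_mx A B N k *m U)) zs).
  have := @avoidance_lhs_diff_convex _ _ _ _ lambda
    (S *m input_mx A B N k) (S *m v) zs Ns0.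
  move=> [f [g [cf cg fgE]]]; exists f, g; split => // U.
  by rewrite -fgE mulmxDr mulmxA addrC.
split; last first.
  (* The inputs enter only through their difference, which becomes the variable [U]. *)
  exists (fun U => avoidance_lhs (risk_multiplier Ns omega)
    (S *m (A ^+ k *m (xi0 - xj0) + input_mx A B N k *m U))
    (fun l => S *m disturbance_mx A N k *m (Wi l - Wj l))).
  by split => //; exact: diff_convex_affine.
(* The obstacle location is absorbed into the constant part. *)
have [f [g [cf cg fgE]]] := diff_convex_affine (risk_multiplier Ns omega)
  (A ^+ k *m xi0 - o k) (fun l => S *m disturbance_mx A N k *m Wi l).
by exists f, g; split => // U; rewrite -fgE addrAC.
Qed.
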